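(* Let $r\ge 1$ and let $A=\{a(1),\dots,a(r)\}$ be a set of $r$ distinct integers such that $\sum_{i=1}^{k-1}a(i)<a(k)$ for all $1\le k\le r$ and such that the $2^r-1$ sums of nonempty subsets of $A$ are pairwise distinct. Let $A'=\{\alpha(1)<\dots<\alpha(2^r-1)\}$ be the set of these sums, and let $N$ be a positive integer with $N\ge \alpha(2^r-1)=a(1)+\dots+a(r)$. Let $A_N$ be the set of positive integers congruent modulo $N$ to some $a(i)$, and $A'_N$ the set of positive integers congruent modulo $N$ to some $\alpha(i)$. Let $D(A_N;k,n)$ be the number of overpartitions of $n$ into parts taken from $A_N$ having exactly $k$ non-overlined parts. Let $E(A'_N;k,n)$ be the number of overpartitions $n=\lambda_1+\dots+\lambda_s$ of $n$ into parts taken from $A'_N$, having exactly $k$ non-overlined parts, such that for all $1\le i\le s-1$, $$\lambda_i-\lambda_{i+1}\ \ge\ N\big(w(\beta_N(\lambda_{i+1}))-1+\chi(\overline{\lambda_{i+1}})\big)+v(\beta_N(\lambda_{i+1}))-\beta_N(\lambda_{i+1}).$$ Then $D(A_N;k,n)=E(A'_N;k,n)$ for all $k,n$.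
   Context: An overpartition of $n$ is a partition of $n$ (a non-increasing sequence of positive integers summing to $n$) in which the first occurrence of each part size may be overlined; it is written $\lambda_1\ge\lambda_2\ge\dots\ge\lambda_s$ with, among equal part sizes, the overlined one (if any) listed first. For $\alpha\in A'$, $w(\alpha)$ denotes the number of elements of $A$ in the (unique) subset of $A$ whose sum is $\alpha$, and $v(\alpha)$ denotes the smallest element of that subset. $\beta_N(m)$ denotes the least positive residue of $m$ modulo $N$ (an element of $\{1,\dots,N\}$). $\chi(\overline{\lambda_{i+1}})=1$ if $\lambda_{i+1}$ is overlined and $0$ otherwise. *)

(* Defs.v *)
From HB Require Import structures.
From mathcomp Require Import all_boot all_order all_algebra.
Set Implicit Arguments.
Unset Strict Implicit.
Unset Printing Implicit Defensive.
Import Order.TTheory GRing.Theory Num.Theory.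
Local Open Scope ring_scope.

(* A part is a pair (size, overlined?). *)
Definition part := (nat * bool)%type.

(* [x] may be listed immediately before [y]: since among equal sizes the
   overlined part comes first and at most one part is overlined, a repeated
   size is only allowed when the later part is not overlined. *)
Definition part_before : rel part := fun x y =>
  (y.1 < x.1)%N || (x.1 == y.1) && ~~ y.2.

Definition is_overpartition (n : nat) (s : seq part) : bool :=
  [&& all (fun x : part => 0 < x.1)%N s, sorted part_before s
    & (\sum_(x <- s) x.1)%N == n].

Definition non_overlined (s : seq part) : nat :=
  count (fun x : part => ~~ x.2) s.

(* The parts of an overpartition of n are at most n in number and in size, so
   the overpartitions of n are found among the values of [overpart_val]; see
   [overpart_val_inj] and [overpart_val_onto]. *)
Definition overpart_val (n : nat) (l : n.-bseq ('I_n.+1 * bool)) : seq part :=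
  [seq (nat_of_ord x.1, x.2) | x <- l].

Definition count_overpartitions (n : nat) (P : pred (seq part)) : nat :=
  #|[set l : n.-bseq ('I_n.+1 * bool) |
      is_overpartition n (overpart_val l) && P (overpart_val l)]|.

Lemma overpart_val_inj n : injective (@overpart_val n).
Proof.
move=> l1 l2 /inj_map eq12; apply/val_inj/eq12.
by case=> [i b] [j c] /= [/val_inj-> ->].
Qed.

Lemma overpart_val_onto n s :
  is_overpartition n s -> exists l : n.-bseq ('I_n.+1 * bool), s = overpart_val l.
Proof.
case/and3P=> /allP s_gt0 _ /eqP sum_s.
have le_s x : x \in s -> (x.1 <= n)%N.
  by move=> xs; rewrite -sum_s (big_rem x xs) leq_addr.
have sz_s : (size [seq (@inord n x.1, x.2) | x <- s] <= n)%N.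
  rewrite size_map -sum_s -sum1_size big_seq [leqRHS]big_seq.
  by apply: leq_sum => x /s_gt0.
exists (Bseq sz_s); rewrite /overpart_val /= -map_comp -[LHS]map_id.
by apply/eq_in_map => -[m b] /le_s /= le_m; rewrite inordK.
Qed.

(* The set A is enumerated by an injective function a : 'I_r -> int, the
   element a(i) of the set being [a i'] with i' = i - 1; subsets of A are
   given by subsets of 'I_r. *)
Definition subset_sum (r : nat) (a : 'I_r -> int) (S : {set 'I_r}) : int :=
  \sum_(i in S) a i.

(* The nonempty subset of A with sum [alpha]; set0 if alpha is not in A'. *)
Definition subset_of (r : nat) (a : 'I_r -> int) (alpha : int) : {set 'I_r} :=
  odflt set0 [pick S : {set 'I_r} | (S != set0) && (subset_sum a S == alpha)].

Definition w (r : nat) (a : 'I_r -> int) (alpha : int) : nat :=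
  #|subset_of a alpha|.

(* The smallest element of that subset; 0 if alpha is not in A'. *)
Definition v (r : nat) (a : 'I_r -> int) (alpha : int) : int :=
  let S := subset_of a alpha in
  if [pick i in S | [forall j in S, a i <= a j]] is Some i then a i else 0.

(* Least positive residue, in {1, ..., N}. *)
Definition beta (N m : nat) : nat := if (m %% N == 0)%N then N else (m %% N)%N.

Definition in_AN (r : nat) (a : 'I_r -> int) (N : nat) : pred nat := fun m =>
  (0 < m)%N && [exists i, (m%:Z == a i %[mod N%:Z])%Z].

Definition in_A'N (r : nat) (a : 'I_r -> int) (N : nat) : pred nat := fun m =>
  (0 < m)%N &&
  [exists S : {set 'I_r}, (S != set0) && (m%:Z == subset_sum a S %[mod N%:Z])%Z].

(* Difference condition on consecutive parts x = lambda_i, y = lambda_{i+1};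
   the boolean y.2 is used as the number chi. *)
Definition gap (r : nat) (a : 'I_r -> int) (N : nat) : rel part := fun x y =>
  let b := (beta N y.1)%:Z in
  x.1%:Z - y.1%:Z >= N%:Z * ((w a b)%:Z - 1 + (nat_of_bool y.2)%:Z) + v a b - b.

Definition D (r : nat) (a : 'I_r -> int) (N k n : nat) : nat :=
  count_overpartitions n (fun s =>
    all (fun x : part => in_AN a N x.1) s && (non_overlined s == k)).

Definition E (r : nat) (a : 'I_r -> int) (N k n : nat) : nat :=
  count_overpartitions n (fun s =>
    [&& all (fun x : part => in_A'N a N x.1) s, non_overlined s == k
      & sorted (gap a N) s]).

(* Main.v *)
(* Write a part of size N m + alpha(S), with 0 <= m, as a pair (m, S).  The gap
   condition between (m, S) and the next smaller part (m', S') says that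
   (m, max S) is lexicographically at least (m' + |S'| - 1 + chi', min S').  With
   q = Q^N and x_l = Q^a(l), let h_j(m) be the generating function of the chains
   all of whose parts satisfy (m0, max S) >= (m, j).  Removing the smallest part
   gives h_j - h_(j+1) = x_j Z p_j where (eta f)(m) = f(m+1), Z = q^m (d + eta),
   and the p_j satisfy p_(j+1) = (1 + x_j R) p_j for the operator R = eta - Z.
   The closing relation h_r = eta h_0 becomes, for f = h_0,
     (1 - R) f = Z (1 + rho(R)) f,  1 + X rho(X) = prod_l (1 + x_l X).
   Since R Z = q Z R + (q - 1) Z^2, a solution g for the variables q x_l yields
   the solution f for the variables x_l by solving
     prod_l (1 + x_l R) f = prod_l (1 + x_l) g.
   The row m = 0 is an eigenvector of R with eigenvalue - d, so that
   f(0) = prod_l (1 + x_l) / (1 - d x_l) g(0); iterating this gives the product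
   that counts the overpartitions into parts from A_N.
   Working modulo Q^(n+1) makes everything finite: q^m vanishes for m > n, hence
   eta, Z and R are square matrices, and 1 + (multiple of Q) is invertible. *)
Require Import Defs.
From HB Require Import structures.
From mathcomp Require Import all_boot all_order all_algebra.
From mathcomp Require Import qpoly ring zify.
Set Implicit Arguments.
Unset Strict Implicit.
Unset Printing Implicit Defensive.
Import Order.TTheory GRing.Theory Num.Theory.
Local Open Scope ring_scope.

(** * Operators satisfying R Z = q Z R + (q - 1) Z^2 *)

Section Commutation.

Context {K : comNzRingType}.
Implicit Types (x : nat -> K) (q c : K).

Definition prod_poly x j : {poly K} := \prod_(l < j) (1 + x l *: 'X).
(** The polynomial [rho] with [1 + X rho(X) = prod_l (1 + x_l X)]; it enters through
    [h_j = f - Z rho_j(R) f]. *)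
Definition sum_poly x j : {poly K} := \sum_(i < j) x i *: prod_poly x i.

Lemma prod_polyS x j : prod_poly x j.+1 = prod_poly x j * (1 + x j *: 'X).
Proof. by rewrite /prod_poly big_ord_recr. Qed.

Lemma sum_polyS x j : sum_poly x j.+1 = sum_poly x j + x j *: prod_poly x j.
Proof. by rewrite /sum_poly big_ord_recr. Qed.

Lemma prod_polyE x j : prod_poly x j = 1 + 'X * sum_poly x j.
Proof.
elim: j => [|j IHj]; first by rewrite /prod_poly /sum_poly !big_ord0 mulr0 addr0.
rewrite prod_polyS sum_polyS {1}IHj -!mul_polyC IHj; ring.
Qed.

Lemma horner_prod_poly x j c : (prod_poly x j).[c] = \prod_(l < j) (1 + x l * c).
Proof. by rewrite horner_prod; apply: eq_bigr => i _; rewrite !hornerE. Qed.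

Lemma eq_sum_poly x y j : x =1 y -> sum_poly x j = sum_poly y j.
Proof.
move=> xy; apply: eq_bigr => i _; rewrite xy; congr (_ *: _).
by apply: eq_bigr => l _; rewrite xy.
Qed.

Context {m : nat}.
Implicit Types (Z R : 'M[K]_m.+1).

(** Moving a factor [1 + x_l R] past [Z] rescales [x_l] by [q] and leaves a term quadratic in [Z].
    These terms collapse because [X] times the difference of the two sums is the difference of the
    two products. *)
Lemma prod_poly_comm q Z R x j : R * Z = q *: (Z * R) + (q - 1) *: (Z * Z) ->
  horner_mx R (prod_poly x j) * Z =
    Z * horner_mx R (prod_poly (fun l => q * x l) j) +
    Z * (horner_mx R (sum_poly (fun l => q * x l) j - sum_poly x j)) * Z.
Proof.
move=> RZ; set y := fun l => q * x l; elim: j => [|j IHj].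
  by rewrite /prod_poly /sum_poly !big_ord0 subr0 rmorph1 rmorph0
    !(mulr0, mul0r, mulr1, mul1r) addr0.
have piE z : horner_mx R (prod_poly z j.+1) =
    horner_mx R (prod_poly z j) + z j *: (horner_mx R (prod_poly z j) * R).
  by rewrite prod_polyS mulrDr mulr1 -scalerAr rmorphD /= linearZ /= rmorphM /= horner_mx_X.
have rhoE z : horner_mx R (sum_poly z j.+1) =
    horner_mx R (sum_poly z j) + z j *: horner_mx R (prod_poly z j).
  by rewrite sum_polyS rmorphD /= linearZ.
have dE : horner_mx R (sum_poly y j - sum_poly x j) * R =
    horner_mx R (prod_poly y j) - horner_mx R (prod_poly x j).
  rewrite -[X in _ * X](horner_mx_X R) -rmorphM -rmorphB /=; congr (horner_mx _ _).
  by rewrite !prod_polyE; ring.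
move: dE IHj; rewrite !rmorphB /= !piE !rhoE.
set p := horner_mx R (prod_poly x j); set p' := horner_mx R (prod_poly y j).
set s := horner_mx R (sum_poly x j); set s' := horner_mx R (sum_poly y j).
move=> dE IHj.
have E1 : p * R * Z = q *: (p * Z * R) + (q - 1) *: (p * Z * Z).
  by rewrite -mulrA RZ mulrDr -!scalerAr !mulrA.
have E2 : q *: (Z * (s' - s) * Z * R) + (q - 1) *: (Z * (s' - s) * Z * Z) =
    Z * p' * Z - Z * p * Z.
  rewrite -mulrBl -mulrBr -dE mulrA -[RHS](mulrA (Z * (s' - s))) RZ.
  by rewrite [RHS]mulrDr -!scalerAr !mulrA.
have E3 : p * R * Z = q *: (Z * p' * R) + q *: (Z * p' * Z) - Z * p * Z.
  rewrite E1 IHj !(mulrDl (Z * p')); move: E2.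
  move: (Z * p' * R) (Z * p' * Z) (Z * p * Z) => A B C.
  move: (Z * (s' - s) * Z * R) (Z * (s' - s) * Z * Z) => D E.
  move=> /matrixP E2; apply/matrixP => i k; have := E2 i k; rewrite !mxE => H.
  by rewrite !mulrDr addrACA H; ring.
rewrite !(mulrDl, mulrDr) -!(scalerAl, scalerAr) ?mulrA E3 IHj.
rewrite !(mulrDl, mulrDr, mulrN, mulNr, opprD) -!(scalerAl, scalerAr) ?mulrA.
move: (Z * p' * R) (Z * p' * Z) (Z * p * Z) (Z * s * Z) (Z * s' * Z) (Z * p') => A B C D E F.
by apply/matrixP => i k; rewrite !mxE /y; ring.
Qed.

(** The unit row vector at [k] is a left eigenvector of [R], hence of every polynomial in [R]. *)
Lemma horner_mx_row R (k : 'I_m.+1) c (p : {poly K}) (F : 'M[K]_m.+1) j :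
    (forall G : 'M[K]_m.+1, (R * G) k j = c * G k j) ->
  (horner_mx R p * F) k j = p.[c] * F k j.
Proof.
move=> Rk; elim/poly_ind: p F => [|p a IHp] F.
  by rewrite rmorph0 horner0 !mul0r mxE.
rewrite rmorphD rmorphM /= horner_mx_X horner_mx_C hornerMXaddC mulrDl -mulrA mxE.
by rewrite IHp Rk mulrA mulrDl -mulmxE mul_scalar_mx mxE.
Qed.

Lemma fixed_by_nilpotent (A : pzRingType) (u e : A) t :
  u ^+ t = 0 -> u * e = e -> e = 0.
Proof.
move=> ut0 ue; suff <- : u ^+ t * e = e by rewrite ut0 mul0r.
by elim: t {ut0} => [|t IHt]; rewrite ?mul1r // exprS -mulrA IHt.
Qed.

Lemma sum_poly_scaled u Q j :
  sum_poly (fun l => Q * u l) j =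
  Q *: \sum_(i < j) u i *: prod_poly (fun l => Q * u l) i.
Proof. by rewrite scaler_sumr; apply: eq_bigr => i _; rewrite scalerA. Qed.

(* [e] is the defect of the boundary equation for [f]; it vanishes because [x] is
   nilpotent, hence so is the operator relating [e] to itself. *)
Lemma boundary_step q Z R x r c (f g : 'M[K]_m.+1) :
    R * Z = q *: (Z * R) + (q - 1) *: (Z * Z) ->
    let y := fun l => q * x l in
    (1 - R) * g = Z * (1 + horner_mx R (sum_poly y r)) * g ->
    horner_mx R (prod_poly x r) * f = c *: g ->
  let e := (1 - R) * f - Z * (1 + horner_mx R (sum_poly x r)) * f in
  horner_mx R (prod_poly x r) * e =
    Z * horner_mx R (sum_poly y r - sum_poly x r) * e.
Proof.
move=> RZ y gE fE e; have := prod_poly_comm x r RZ; rewrite -/y.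
have pR : horner_mx R (prod_poly x r) * (1 - R) = (1 - R) * horner_mx R (prod_poly x r).
  rewrite mulrBl mulrBr mulr1 mul1r; congr (_ - _).
  by have := comm_horner_mx2 R (prod_poly x r) 'X; rewrite horner_mx_X.
(* A polynomial identity in [R]. Its last term and the quadratic term of the commutation both carry
   the factor [rho_y(R) - rho_x(R)], and together they reproduce [e]. *)
have key : (1 + horner_mx R (sum_poly y r)) * horner_mx R (prod_poly x r) =
    horner_mx R (prod_poly y r) * (1 + horner_mx R (sum_poly x r)) +
    horner_mx R (sum_poly y r - sum_poly x r) * (1 - R).
  have hB : 1 - R = horner_mx R (1 - 'X) by rewrite rmorphB rmorph1 /= horner_mx_X.
  have hD v : 1 + horner_mx R v = horner_mx R (1 + v) by rewrite rmorphD rmorph1.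
  rewrite hB !hD -!rmorphM -rmorphD; congr (horner_mx _ _).
  by rewrite !prod_polyE; ring.
have lhs : horner_mx R (prod_poly x r) * ((1 - R) * f) =
   Z * ((1 + horner_mx R (sum_poly y r)) * horner_mx R (prod_poly x r)) * f.
  by rewrite mulrA pR -[LHS]mulrA fE -scalerAr gE [in RHS]mulrA -[RHS]mulrA fE -scalerAr.
move: lhs; rewrite key /e; set p := horner_mx R (prod_poly x r).
set p' := horner_mx R (prod_poly y r); set s := 1 + horner_mx R (sum_poly x r).
set t := horner_mx R (_ - _) => lhs pZ.
rewrite mulrBr lhs -(mulrA Z s f) (mulrA p) pZ mulrDr 2!mulrDl [RHS]mulrBr !mulrA.
by rewrite opprD addrACA subrr add0r.
Qed.

(** As every [x_l] is a multiple of the nilpotent [Q], the product of the [1 + x_l R] is invertible,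
    which defines [f]; the same nilpotency makes the defect vanish. *)
Lemma boundary_solution q Q t Z R u r c (g : 'M[K]_m.+1) :
    R * Z = q *: (Z * R) + (q - 1) *: (Z * Z) -> Q ^+ t = 0 ->
    let x := fun l => Q * u l in let y := fun l => q * x l in
    (1 - R) * g = Z * (1 + horner_mx R (sum_poly y r)) * g ->
  exists2 f : 'M[K]_m.+1, horner_mx R (prod_poly x r) * f = c *: g &
    (1 - R) * f = Z * (1 + horner_mx R (sum_poly x r)) * f.
Proof.
move=> RZ Qt0 x y gE.
have nilp (A : 'M[K]_m.+1) : (Q *: A) ^+ t = 0 by rewrite exprZn Qt0 scale0r.
set s := \sum_(i < r) u i *: prod_poly x i.
have sE : sum_poly x r = Q *: s by rewrite [LHS]sum_poly_scaled.
pose w := - horner_mx R ('X * s).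
have pE : horner_mx R (prod_poly x r) = 1 - Q *: w.
  by rewrite prod_polyE sE rmorphD rmorph1 /= -scalerAr linearZ /= scalerN opprK.
(* A finite geometric series inverts [1 - Q w]. *)
pose f : 'M[K]_m.+1 := (\sum_(i < t) (Q *: w) ^+ i) * (c *: g).
have fE : horner_mx R (prod_poly x r) * f = c *: g.
  rewrite pE /f mulrA -opprB mulNr -subrX1 nilp sub0r opprK mul1r //.
exists f => //; apply/eqP; rewrite -subr_eq0; apply/eqP.
have := boundary_step RZ gE fE; rewrite /=; set e := (X in _ * X = _).
rewrite pE mulrBl mul1r.
have -> : sum_poly y r - sum_poly x r =
    Q *: (\sum_(i < r) (q * u i) *: prod_poly y i - s).
  rewrite scalerBr -sE; congr (_ - _); rewrite scaler_sumr; apply: eq_bigr => i _.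
  by rewrite scalerA /y /x mulrCA.
rewrite linearZ /= -scalerAr => /(canRL (subrK _)); rewrite -mulrDl -scalerDr => eE.
exact: fixed_by_nilpotent (nilp _) (esym eE).
Qed.

End Commutation.

(** * Solving the boundary equation with matrices *)

Section Solution.

Context {K : comNzRingType}.
Variables (m : nat) (q d : K).
Hypothesis qm0 : q ^+ m = 0.

(* The index [m] stands for all larger ones: [q ^+ m = 0] makes the sequences
   constant from there on. *)
Definition shift_mx : 'M[K]_m.+1 := \matrix_(i, j) (j == minn i.+1 m :> nat)%:R.
Definition raise_mx : 'M[K]_m.+1 :=
  diag_mx (\row_i q ^+ i) * (d%:M + shift_mx).
Definition red_mx : 'M[K]_m.+1 := shift_mx - raise_mx.

(** Functions are stored in the first column of a square matrix, so that operators and functions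
    multiply in one ring. Indices beyond [m] read the last row. *)
Definition entry (f : 'M[K]_m.+1) (i : nat) : K := f (inord (minn i m)) ord0.

Lemma inord_minn i : (inord (minn i m) : 'I_m.+1) = minn i m :> nat.
Proof. by rewrite inordK // ltnS geq_minr. Qed.

Lemma shift_mxE (f : 'M[K]_m.+1) (k l : 'I_m.+1) :
  (shift_mx * f) k l = f (inord (minn k.+1 m)) l.
Proof.
rewrite mxE (bigD1 (inord (minn k.+1 m))) //= mxE inord_minn eqxx mul1r.
rewrite big1 ?addr0 // => i; rewrite mxE -val_eqE /= inord_minn => /negPf ->.
by rewrite mul0r.
Qed.

Lemma raise_mxE (f : 'M[K]_m.+1) (k l : 'I_m.+1) :
  (raise_mx * f) k l = q ^+ k * (d * f k l + f (inord (minn k.+1 m)) l).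
Proof.
rewrite /raise_mx -mulrA -mulmxE mul_diag_mx mxE mxE mulmxDl mul_scalar_mx mxE.
by rewrite [X in X + _]mxE mulmxE shift_mxE.
Qed.

Lemma entry_shift f i : entry (shift_mx * f) i = entry f i.+1.
Proof.
by rewrite /entry shift_mxE inord_minn -minnSS -minnA (minn_idPr (leqnSn m)).
Qed.

Lemma qm_eq0 i : (m <= i)%N -> q ^+ i = 0.
Proof. by move/subnK <-; rewrite exprD qm0 mulr0. Qed.

Lemma entry_raise f i :
  entry (raise_mx * f) i = q ^+ i * (d * entry f i + entry f i.+1).
Proof.
have [im | mi] := leqP i m; last first.
  by rewrite /entry raise_mxE inord_minn (minn_idPr (ltnW mi)) qm0 (qm_eq0 (ltnW mi)) !mul0r.
by rewrite /entry raise_mxE inord_minn (minn_idPl im).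
Qed.

(** The shift turns [q ^ k] into [q ^ (k + 1)]. In the last row, where the index is capped, both
    sides vanish because [q ^ m = 0]. *)
Lemma shift_raise : shift_mx * raise_mx = q *: (raise_mx * shift_mx).
Proof.
have shiftE k l : shift_mx k l = (1 : 'M_m.+1) (inord (minn k.+1 m)) l.
  by rewrite -[in LHS](mulr1 shift_mx) shift_mxE.
apply/matrixP => k l; rewrite shift_mxE [RHS]mxE raise_mxE -[raise_mx]mulr1 raise_mxE.
rewrite !shiftE mulrA -exprS; have [km | mk] := leqP k.+1 m; first by rewrite inordK.
by rewrite !qm_eq0 ?inordK // ltnW.
Qed.

Lemma red_raise :
  red_mx * raise_mx = q *: (raise_mx * red_mx) + (q - 1) *: (raise_mx * raise_mx).
Proof.
rewrite /red_mx mulrBl mulrBr shift_raise scalerBr scalerBl scale1r.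
by rewrite addrA subrK.
Qed.

Lemma red_row0 (f : 'M[K]_m.+1) l : (red_mx * f) ord0 l = - d * f ord0 l.
Proof.
rewrite mulrBl mxE [X in _ + X]mxE shift_mxE raise_mxE expr0 mul1r opprD.
by rewrite addrCA subrr addr0 mulNr.
Qed.

Lemma red_row_max (f : 'M[K]_m.+1) l : (red_mx * f) ord_max l = 1 * f ord_max l.
Proof.
rewrite mulrBl mxE [X in _ + X]mxE shift_mxE raise_mxE qm0 mul0r subr0 mul1r.
by congr (f _ _); apply/val_inj; rewrite /= inord_minn (minn_idPr (leqnSn m)).
Qed.

(** Induction on the number [t] of rescalings by [q] after which all variables vanish. Row [0] of
    the relation between [f] and [g] supplies the factors with [i = 0]; the last row keeps the
    normalisation. *)
Lemma boundary_solution_exists Q s r t (u : nat -> K) :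
    Q ^+ s = 0 -> (forall l, q ^+ t * (Q * u l) = 0) ->
  exists f : 'M[K]_m.+1,
    [/\ (1 - red_mx) * f =
          raise_mx * (1 + horner_mx red_mx (sum_poly (fun l => Q * u l) r)) * f,
        f ord_max ord0 = 1 &
        f ord0 ord0 * \prod_(i < t) \prod_(l < r) (1 - d * (Q * u l) * q ^+ i) =
        \prod_(i < t) \prod_(l < r) (1 + Q * u l * q ^+ i)].
Proof.
move=> Qs0; elim: t u => [|t IHt] u qtu.
  (* For vanishing variables the equation reduces to [eta f = f], solved by a constant. *)
  exists (const_mx 1); split; rewrite ?mxE ?big_ord0 ?mulr1 //.
  have -> : sum_poly (fun l => Q * u l) r = 0.
    by apply: big1 => i _; rewrite -(mul1r (Q * _)) -(expr0 q) qtu scale0r.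
  rewrite rmorph0 addr0 mulr1 mulrBl mul1r /red_mx mulrBl opprB addrC -addrA.
  rewrite -[RHS]addr0; congr (_ + _); apply/matrixP => k l.
  by rewrite mxE [X in X + _]mxE shift_mxE !mxE addNr.
have [l|g [gE gmax g0]] := IHt (fun l => q * u l).
  by rewrite -[RHS](qtu l) exprS; ring.
have ysE : sum_poly (fun l => q * (Q * u l)) r = sum_poly (fun l => Q * (q * u l)) r.
  by apply: eq_sum_poly => l; rewrite mulrCA.
(* The value at the eigenvalue [1] of the last row: this choice gives [f] the same last entry as
   [g]. *)
pose c := (prod_poly (fun l => Q * u l) r).[1].
have [|f fE fsol] := boundary_solution (u := u) (r := r) c red_raise Qs0 (g := g).
  by rewrite ysE.
exists f; split=> //.
  have := congr1 (fun F : 'M_m.+1 => F ord_max ord0) fE.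
  rewrite /= (horner_mx_row _ _ (c := 1)) => [|G]; last exact: red_row_max.
  rewrite [RHS]mxE gmax mulr1 -/c => cE; apply/eqP; rewrite -subr_eq0; apply/eqP.
  (* [c] is [1] plus a nilpotent element, so it can be cancelled. *)
  have nilp v : (Q * v) ^+ s = 0 by rewrite exprMn Qs0 mul0r.
  move: cE; rewrite /c prod_polyE sum_poly_scaled !hornerE.
  set v := horner _ _ => cE; apply: (fixed_by_nilpotent (nilp (- v))).
  apply/eqP; rewrite -subr_eq0.
  rewrite (_ : _ - _ = (1 + Q * v) - (1 + Q * v) * f ord_max ord0); last by ring.
  by rewrite cE subrr.
have := congr1 (fun F : 'M_m.+1 => F ord0 ord0) fE.
rewrite /= (horner_mx_row _ _ (c := - d)) => [|G]; last exact: red_row0.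
rewrite horner_prod_poly => c0; rewrite [RHS]mxE in c0.
rewrite !big_ord_recl mulrA [f _ _ * _]mulrC.
rewrite [X in X * _](_ : _ = c * g ord0 ord0); last first.
  rewrite -c0; congr (_ * _); apply: eq_bigr => l _; rewrite expr0; ring.
rewrite -mulrA; congr (_ * _).
  by rewrite /c horner_prod_poly; apply: eq_bigr => l _; rewrite expr0.
rewrite (_ : \prod_(i < t) _ = 
   \prod_(i < t) \prod_(l < r) (1 - d * (Q * (q * u l)) * q ^+ i)); last first.
  by apply: eq_bigr => i _; apply: eq_bigr => l _; rewrite lift0 exprS; ring.
rewrite g0; apply: eq_bigr => i _; apply: eq_bigr => l _; rewrite lift0 exprS; ring.
Qed.


Lemma entryB f g i : entry (f - g) i = entry f i - entry g i.
Proof. by rewrite /entry 2!mxE. Qed.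

Lemma entryD f g i : entry (f + g) i = entry f i + entry g i.
Proof. by rewrite /entry mxE. Qed.

Lemma entryZ c f i : entry (c *: f) i = c * entry f i.
Proof. by rewrite /entry mxE. Qed.

(** With [h_j = f - Z rho_j(R) f] and [p_j = prod_(l<j) (1 + x_l R) f], the boundary equation for
    [f] says exactly that [h_r = eta h_0]. *)
Lemma chain_functions Q s r (u : nat -> K) : Q ^+ s = 0 ->
  let x := fun l => Q * u l in
  exists h p : nat -> nat -> K,
    [/\ forall j i, h j.+1 i = h j i - x j * (q ^+ i * (d * p j i + p j i.+1)),
        forall j i, p j.+1 i = h j.+1 i + (p j i - h j i) + x j * p j i.+1,
        forall i, p 0%N i = h 0%N i /\ h r i = h 0%N i.+1,
        forall j i, (m <= i)%N -> h j i = 1 &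
        h 0%N 0%N * \prod_(i < m) \prod_(l < r) (1 - d * x l * q ^+ i) =
        \prod_(i < m) \prod_(l < r) (1 + x l * q ^+ i)].
Proof.
move=> Qs0 x.
have [l|f [fE fmax f0]] := @boundary_solution_exists Q s r m u Qs0.
  by rewrite qm0 mul0r.
pose P j := horner_mx red_mx (prod_poly x j) * f.
pose H j := f - raise_mx * (horner_mx red_mx (sum_poly x j) * f).
have HS j : H j.+1 = H j - x j *: (raise_mx * P j).
  rewrite /H sum_polyS rmorphD /= linearZ /= mulrDl mulrDr opprD addrA.
  by rewrite -scalerAl -scalerAr.
have PS j : P j.+1 = H j.+1 + (P j - H j) + x j *: (shift_mx * P j).
  rewrite {1}/P prod_polyS mulrDr mulr1 -scalerAr rmorphD /= linearZ /= rmorphM /=.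
  have -> : horner_mx red_mx (prod_poly x j) * horner_mx red_mx 'X =
      red_mx * horner_mx red_mx (prod_poly x j).
    by rewrite [LHS]comm_horner_mx2 horner_mx_X.
  rewrite mulrDl -scalerAl -mulrA.
  rewrite -/(P j) /red_mx mulrBl scalerBr HS.
  move: (x j *: (raise_mx * P j)) (x j *: (shift_mx * P j)) (P j) (H j) => a b v w.
  by apply/matrixP => k l; rewrite !mxE; ring.
have x0 : sum_poly x 0 = 0 by rewrite /sum_poly big_ord0.
exists (fun j => entry (H j)), (fun j => entry (P j)); split.
- by move=> j i /=; rewrite HS [LHS]entryB entryZ entry_raise.
- by move=> j i /=; rewrite PS entryD (entryD (H j.+1)) (entryB (P j)) entryZ entry_shift.
- move=> i /=; split.
    by rewrite /P /H x0 rmorph0 mul0r mulr0 subr0 /prod_poly big_ord0 rmorph1 mul1r.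
  rewrite -entry_shift; congr (entry _ i).
  rewrite /H x0 rmorph0 mul0r mulr0 subr0; move: fE.
  rewrite mulrBl mul1r /red_mx mulrBl mulrDr mulr1 mulrDl -/x -mulrA => fE.
  move: (shift_mx * f) (raise_mx * f) (raise_mx * (_ * f)) fE => a b c.
  by move/(canRL (subrK _)) ->; apply/matrixP => k l; rewrite !mxE; ring.
- move=> j i mi /=; rewrite entryB.
  suff e1 g : entry (raise_mx * g) i = 0.
    rewrite e1 subr0 -[RHS]fmax /entry (minn_idPr mi); congr (f _ _).
    by apply/val_inj; rewrite /= inordK.
  by rewrite entry_raise qm_eq0 // mul0r.
- rewrite /H x0 rmorph0 mul0r mulr0 subr0 -f0 /entry min0n; congr (f _ _ * _).
  by apply/val_inj; rewrite /= inordK.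
Qed.

End Solution.

(** * Generating functions of chains of parts *)

Lemma big_bseq0 (V : nmodType) (T : finType) (F : seq T -> V) :
  \sum_(l : 0.-bseq T) F l = F [::].
Proof.
rewrite (big_pred1 [bseq of [::]]) // => l; apply/esym/eqP/val_inj => /=.
by case: l => [[|x s] sz].
Qed.

Lemma big_bseqS (V : nmodType) (T : finType) L (F : seq T -> V) :
  \sum_(l : L.+1.-bseq T) F l = F [::] + \sum_x \sum_(l : L.-bseq T) F (x :: l).
Proof.
have bs M : uniq [seq val l | l : M.-bseq T].
  by rewrite map_inj_uniq ?enum_uniq //; apply: val_inj.
have bm M s : (s \in [seq val l | l : M.-bseq T]) = (size s <= M)%N.
  apply/mapP/idP => [[l _ ->]|sM]; first exact: size_bseq.
  by exists (Bseq sM); rewrite ?mem_enum.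
have bigE M G : \sum_(l : M.-bseq T) G (val l) =
    \sum_(s <- [seq val l | l : M.-bseq T]) G s :> V.
  by rewrite big_map big_enum.
rewrite (bigE _ F).
rewrite (perm_big ([::] :: [seq x :: s | x <- enum T, s <- [seq val l | l : L.-bseq T]])) /=.
  rewrite big_cons big_allpairs_dep big_enum; congr (_ + _).
  by apply: eq_bigr => x _; rewrite (bigE _ (fun s => F (x :: s))).
apply: uniq_perm => //=.
  rewrite allpairs_uniq ?enum_uniq // ?andbT; last by move=> [x s] [y t] _ _ [-> ->].
  by apply/negP => /allpairsP[[x s] []].
move=> s; rewrite bm inE; case: s => [|x s] //=.
rewrite ltnS; apply/idP/allpairsP => [sL|[[y t] /= [_ tL [_ ->]]]]; last by rewrite -bm.
by exists (x, s); rewrite mem_enum bm.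
Qed.

Lemma big_bseq_rev (V : nmodType) (T : finType) L (F : seq T -> V) :
  \sum_(l : L.-bseq T) F l = \sum_(l : L.-bseq T) F (rev l).
Proof.
pose h (l : L.-bseq T) : L.-bseq T := [bseq of rev l].
rewrite (reindex_inj (h := h)) //.
by move=> l1 l2 /(congr1 val) /= /(can_inj revK) /val_inj.
Qed.

Section ChainSum.

Context {K : comNzRingType}.
Variables (Q d : K) (n : nat).
Hypothesis Qn0 : Q ^+ n.+1 = 0.

Definition part_weight (x : part) : K := Q ^+ x.1 * (if x.2 then 1 else d).

Definition part_val (x : 'I_n.+1 * bool) : part := (nat_of_ord x.1, x.2).

(* Dropping the smallest part and truncating modulo [Q ^+ n.+1] shows that the
   recursion on [g] has only one solution. *)
Lemma chain_sum (A : pred part) (e : rel part) (g : part -> K) :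
    (forall x, A x -> 0 < x.1)%N ->
    (forall y, A y -> g y = 1 +
      \sum_(x : 'I_n.+1 * bool | A (part_val x) && e (part_val x) y)
         part_weight (part_val x) * g (part_val x)) ->
  \sum_(l : n.-bseq ('I_n.+1 * bool) |
      all A (overpart_val l) && sorted e (overpart_val l))
    \prod_(x <- overpart_val l) part_weight x =
  1 + \sum_(x : 'I_n.+1 * bool | A (part_val x))
         part_weight (part_val x) * g (part_val x).
Proof.
(* Chains are read from the smallest part upward, hence the reversed relation. *)
move=> A_gt0 gE; pose e' : rel ('I_n.+1 * bool) := fun y x => e (part_val x) (part_val y).
pose A' x := A (part_val x).
pose wt (s : seq ('I_n.+1 * bool)) := \prod_(x <- s) part_weight (part_val x).
(* [W y L] runs over the chains of at most [L] parts that can be listed before [y]. *)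
pose W y L := \sum_(l : L.-bseq ('I_n.+1 * bool)) if all A' l && path e' y l then wt l else 0.
have WS y L : W y L.+1 = 1 + \sum_(x | A' x && e' y x) part_weight (part_val x) * W x L.
  rewrite /W (big_bseqS L (fun l => if all A' l && path e' y l then wt l else 0)) /=.
  rewrite /wt big_nil [in RHS]big_mkcond; congr (_ + _).
  apply: eq_bigr => x _; case: (A' x) => /=; last by rewrite big1.
  case: (e' y x); last by rewrite big1 // => l _; rewrite andbF.
  rewrite mulr_sumr; apply: eq_bigr => l _.
  by case: ifP => _; rewrite ?mulr0 // big_cons.
have W0 y : W y 0 = 1.
  rewrite /W (big_bseq0 (fun l => if all A' l && path e' y l then wt l else 0)) /=.
  by rewrite /wt big_nil.
have pwE x : A' x -> exists c, part_weight (part_val x) = Q * c.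
  move=> /A_gt0; rewrite /part_weight; case: (part_val x) => [[|i] b] //= _.
  by rewrite exprS -mulrA; exists (Q ^+ i * (if b then 1 else d)).
have approxS (B : pred ('I_n.+1 * bool)) u L :
    (forall x, A' x -> exists c, g (part_val x) = u x + Q ^+ L * c) ->
  exists c, \sum_(x | A' x && B x) part_weight (part_val x) * g (part_val x) =
    \sum_(x | A' x && B x) part_weight (part_val x) * u x + Q ^+ L.+1 * c.
  move=> gu; elim/big_rec2: _ => [|x u1 u2 /andP[Ax _] [c ->]].
    by exists 0; rewrite mulr0 addr0.
  have [c1 ->] := gu x Ax; have [c2 ->] := pwE x Ax.
  by exists (c2 * c1 + c); rewrite (exprS Q L); ring.
have approx0 (B : pred ('I_n.+1 * bool)) :
  exists c, \sum_(x | A' x && B x) part_weight (part_val x) * g (part_val x) = Q * c.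
  have [|c ->] := approxS B (fun=> 0) 0.
    by move=> x _; exists (g (part_val x)); rewrite add0r mul1r.
  by exists c; rewrite big1 ?add0r // => x _; rewrite mulr0.
(* Every further part brings a factor [Q], so [g] and [W] agree modulo [Q ^ (L + 1)]. *)
have W_approx L y : A' y -> exists c, g (part_val y) = W y L + Q ^+ L.+1 * c.
  elim: L y => [|L IHL] y Ay; rewrite gE //.
    by rewrite W0; have [c ->] := approx0 (e' y); exists c.
  rewrite WS; have [c ->] := approxS (e' y) (fun x => W x L) L.+1 IHL.
  by exists c; rewrite addrA.
have start : \sum_(l : n.-bseq ('I_n.+1 * bool) |
      all A (overpart_val l) && sorted e (overpart_val l))
    \prod_(x <- overpart_val l) part_weight x =
    \sum_(l : n.-bseq ('I_n.+1 * bool)) if all A' l && sorted e' l then wt l else 0.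
  rewrite big_mkcond.
  pose F (s : seq ('I_n.+1 * bool)) :=
    let t := [seq part_val x | x <- s] in
    if all A t && sorted e t then \prod_(x <- t) part_weight x else 0.
  rewrite (big_bseq_rev n F); apply: eq_bigr => l _; rewrite /F /=.
  rewrite map_rev all_rev rev_sorted sorted_map all_map.
  case: ifP => // _; rewrite /wt -(big_map part_val predT part_weight)
    (perm_big [seq part_val x | x <- l]) //.
  by rewrite perm_rev.
rewrite start; pose T L : K :=
  \sum_(l : L.-bseq ('I_n.+1 * bool)) if all A' l && sorted e' l then wt l else 0.
have TS L : T L.+1 = 1 + \sum_(x | A' x) part_weight (part_val x) * W x L.
  rewrite /T (big_bseqS L (fun l => if all A' l && sorted e' l then wt l else 0)) /=.
  rewrite /wt big_nil [in RHS]big_mkcond; congr (_ + _).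
  apply: eq_bigr => x _; case: (A' x) => /=; last by rewrite big1.
  rewrite mulr_sumr; apply: eq_bigr => l _.
  by case: ifP => _; rewrite ?mulr0 // big_cons.
suff total L : exists c, 1 + \sum_(x | A' x) part_weight (part_val x) * g (part_val x) =
    T L + Q ^+ L.+1 * c.
  by have [c ->] := total n; rewrite Qn0 mul0r addr0.
have AT F : \sum_(x | A' x) F x = \sum_(x | A' x && predT x) F x :> K.
  by apply: eq_bigl => x; rewrite andbT.
case: L => [|L].
  rewrite AT; have [c ->] := approx0 predT; exists c.
  by rewrite /T (big_bseq0 (fun l => if all A' l && sorted e' l then wt l else 0)) /=
    /wt big_nil.
rewrite AT; have [c ->] := approxS predT (fun x => W x L) L.+1 (W_approx L).
by exists c; rewrite TS AT addrA.
Qed.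
End ChainSum.

(** * Residues modulo [N] in the range from [1] to [N] *)

Lemma residue_inj N m1 m2 b1 b2 : (0 < b1 <= N)%N -> (0 < b2 <= N)%N ->
  (N * m1 + b1 == N * m2 + b2)%N = (m1 == m2) && (b1 == b2).
Proof.
move=> b1N b2N; apply/eqP/andP => [e|[/eqP-> /eqP->] //].
have [m12|m21|m12] := ltngtP m1 m2.
- have : (N * m1.+1 <= N * m2)%N by rewrite leq_mul.
  by rewrite mulnS; lia.
- have : (N * m2.+1 <= N * m1)%N by rewrite leq_mul.
  by rewrite mulnS; lia.
- by move: e; rewrite m12 => /addnI ->.
Qed.

(** As the residue [N] replaces [0], the quotient is that of [l - 1]. *)
Lemma residueE N l s : (0 < l)%N -> (0 < s <= N)%N -> l = s %[mod N] ->
  l = (N * (l.-1 %/ N) + s)%N.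
Proof.
move=> l_gt0 sN ls; have lE : (l.-1 %% N)%N = s.-1.
  rewrite -[RHS](@modn_small _ N); last by lia.
  by apply/eqP; rewrite -(eqn_modDr 1) !addn1 !prednK ?ls //; lia.
by have := divn_eq l.-1 N; rewrite lE; lia.
Qed.

Lemma big_residues (V : Type) (idx : V) (op : Monoid.com_law idx)
    (I : finType) (C : pred I) (alpha : I -> nat) (N n : nat) (f : nat -> V) :
    (forall i, C i -> 0 < alpha i <= N)%N ->
    {in C &, injective alpha} -> (forall l, (n < l)%N -> f l = idx) ->
  \big[op/idx]_(l < n.+1 | (0 < l)%N && [exists i, C i && (l == alpha i %[mod N])]) f l =
  \big[op/idx]_(m < n.+1) \big[op/idx]_(i | C i) f (N * m + alpha i)%N.
Proof.
move=> alphaP alpha_inj f_big.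
have [i0 Ci0|noC] := pickP C; last first.
  rewrite [RHS]big1 => [|m _]; last by rewrite big_pred0.
  by rewrite big1 // => l /andP[_ /existsP[i]]; rewrite noC.
have N_gt0 : (0 < N)%N by have := alphaP _ Ci0; lia.
pose D l := (0 < l)%N && [exists i, C i && (l == alpha i %[mod N])].
(* A bound above every [N m + alpha i] with [m <= n]; both sides become iterations over the range
   below it, where the terms beyond [n] are trivial. *)
pose M := (N * n.+1).+1.
have nM : (n < M)%N by rewrite /M; nia.
rewrite (big_ord_widen_cond M D) // big_mkcondr /=.
rewrite -(big_mkord D (fun l => if (l < n.+1)%N then f l else idx)).
rewrite (eq_bigr f) => [|l _]; last by case: ltnP => // /f_big.
rewrite -big_filter.
rewrite (perm_big [seq (N * m + alpha i)%N | m <- index_iota 0 n.+1, i <- enum C]).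
  rewrite big_allpairs_dep big_mkord; apply: eq_bigr => m _; exact: big_enum.
apply: uniq_perm; first by rewrite filter_uniq ?iota_uniq.
  rewrite allpairs_uniq ?enum_uniq ?iota_uniq // => -[m1 i1] [m2 i2].
  case/allpairsP=> -[m i] [_ Ci1 [-> ->]] /allpairsP[[m' i'] [_ Ci2 [-> ->]]].
  rewrite !mem_enum /= in Ci1 Ci2 *; move/eqP; rewrite residue_inj ?alphaP //.
  case/andP=> /eqP-> /eqP.
  by move/alpha_inj => ->.
move=> l; rewrite mem_filter mem_index_iota.
apply/andP/allpairsP => [[/andP[l_gt0 /existsP[i /andP[Ci /eqP li]]] lM]|[[m i] [mn Ci ->]]].
  have a_gt0 : (0 < alpha i <= N)%N by apply: alphaP.
  exists (l.-1 %/ N, i)%N; rewrite mem_enum mem_index_iota /=; split=> //.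
    by rewrite ltn_divLR //; move: lM; rewrite /M; nia.
  exact: residueE.
move: mn Ci; rewrite mem_enum mem_index_iota /= => mn Ci; have := alphaP i Ci => a_gt0.
split; last by rewrite /M; nia.
apply/andP; split; first by lia.
by apply/existsP; exists i; rewrite mulnC modnMDl eqxx andbT.
Qed.

(** * Extracting the counts as coefficients *)

Section Count.

Variable n : nat.

(** The outer variable is [Q], truncated modulo [Q ^ (n + 1)]; the inner one is [d], which marks
    non-overlined parts. *)
Let K := {poly %/ ('X^(n.+1) : {poly {poly int}})}.
Let inK : {poly {poly int}} -> K := in_qpoly 'X^(n.+1).

Definition qvar : K := inK 'X.
Definition dvar : K := inK 'X%:P.

Lemma qvar_nilp : qvar ^+ n.+1 = 0.
Proof.
rewrite /qvar /inK -rmorphXn; apply/val_inj => /=.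
by rewrite mk_monic_Xn Pdiv.RingMonic.rmodpp // monicXn.
Qed.

(** Both cardinalities are coefficients of [Q ^ n d ^ k], which reduction modulo [Q ^ (n + 1)]
    preserves. *)
Lemma count_from_weights (B1 B2 : pred (seq part)) k :
  \sum_(l : n.-bseq ('I_n.+1 * bool) | B1 (overpart_val l))
     \prod_(x <- overpart_val l) part_weight qvar dvar x =
  \sum_(l : n.-bseq ('I_n.+1 * bool) | B2 (overpart_val l))
     \prod_(x <- overpart_val l) part_weight qvar dvar x ->
  #|[set l : n.-bseq ('I_n.+1 * bool) | [&& B1 (overpart_val l),
     \sum_(x <- overpart_val l) x.1 == n & non_overlined (overpart_val l) == k]]%N| =
  #|[set l : n.-bseq ('I_n.+1 * bool) | [&& B2 (overpart_val l),
     \sum_(x <- overpart_val l) x.1 == n & non_overlined (overpart_val l) == k]]%N|.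
Proof.
pose P (B : pred (seq part)) : {poly {poly int}} :=
  \sum_(l : n.-bseq ('I_n.+1 * bool) | B (overpart_val l))
   'X^(\sum_(x <- overpart_val l) x.1) * ('X^(non_overlined (overpart_val l)))%:P.
have PE B : inK (P B) = \sum_(l : n.-bseq ('I_n.+1 * bool) | B (overpart_val l))
     \prod_(x <- overpart_val l) part_weight qvar dvar x.
  rewrite /inK rmorph_sum; apply: eq_bigr => l _.
  elim: (overpart_val l) => [|x s IHs]; first by rewrite !big_nil mulr1 rmorph1.
  rewrite !big_cons -IHs /= exprD exprD !rmorphM /= rmorphXn /part_weight /qvar /dvar /inK.
  by case: x.2 => /=; rewrite ?expr0 ?expr1 ?rmorph1; ring.
have coefP B : (P B)`_n`_k = #|[set l : n.-bseq ('I_n.+1 * bool) | [&& B (overpart_val l),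
     \sum_(x <- overpart_val l) x.1 == n & non_overlined (overpart_val l) == k]]%N|%:Z.
  rewrite -natz -sum1dep_card natr_sum coef_sum coef_sum [RHS]big_mkcondr.
  apply: eq_bigr => l _; rewrite coefMC coefXn [n == _]eq_sym.
  case: (_ == n); last by rewrite mul0r coef0.
  by rewrite mul1r coefXn eq_sym; case: (_ == k).
rewrite -!PE => /(congr1 val) /=; rewrite mk_monic_Xn -!Pdiv.RingMonic.take_poly_rmodp.
move=> /(congr1 (fun p : {poly {poly int}} => p`_n`_k)).
rewrite !coef_take_poly ltnS leqnn !coefP => -[].
by [].
Qed.

End Count.

(** * Overpartitions without gap condition *)

Lemma sum_parts (V : nmodType) n (P : pred 'I_n) (F : 'I_n * bool -> V) :
  \sum_(x | P x.1) F x = \sum_(l | P l) (F (l, true) + F (l, false)).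
Proof.
transitivity (\sum_(x | P x.1 && xpredT x.2) F (x.1, x.2)).
  by apply: eq_big => [x|[]//]; rewrite andbT.
rewrite -(pair_big P xpredT (fun l c => F (l, c))) /=.
by apply: eq_bigr => l _; rewrite big_bool.
Qed.

Section Products.

Context {K : comNzRingType}.
Variables (Q d : K) (n : nat).
Hypothesis Qn0 : Q ^+ n.+1 = 0.

(* Inverse of [1 - u] when [u ^+ n.+1 = 0]. *)
Definition geom (u : K) : K := \sum_(i < n.+1) u ^+ i.

Lemma geomK c l : (0 < l)%N -> (1 - c * Q ^+ l) * geom (c * Q ^+ l) = 1.
Proof.
case: l => // l _; rewrite -opprB mulNr -subrX1 exprMn -exprM mulSn exprD.
by rewrite Qn0 mul0r mulr0 sub0r opprK.
Qed.

(** The truncated [(1 + Q^l) / (1 - d Q^l)]: at most one overlined part of size [l] and any number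
    of non-overlined ones. *)
Definition part_factor l : K := (1 + Q ^+ l) * geom (d * Q ^+ l).

Lemma Q_big l : (n < l)%N -> Q ^+ l = 0.
Proof. by move/subnK <-; rewrite exprD Qn0 mulr0. Qed.

Lemma part_factor_big l : (n < l)%N -> part_factor l = 1.
Proof.
move=> nl; rewrite /part_factor -[RHS](@geomK d l) ?(leq_ltn_trans _ nl) //.
by rewrite Q_big // mulr0 subr0 addr0.
Qed.

Lemma overpartition_sum (B : pred nat) : (forall l, B l -> 0 < l)%N ->
  \sum_(l : n.-bseq ('I_n.+1 * bool) |
     all (fun x => B x.1) (overpart_val l) && sorted part_before (overpart_val l))
     \prod_(x <- overpart_val l) part_weight Q d x =
  \prod_(l < n.+1 | B l) part_factor l.
Proof.
move=> B_gt0; pose F p := \prod_(p <= l < n.+1 | B l) part_factor l.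
have F_sum p : F p = 1 + \sum_(l < n.+1 | B l && (p <= l)%N) Q ^+ l * (F l.+1 + d * F l).
  have [pn | np] := leqP p n.+1; last first.
    rewrite /F big_geq ?(ltnW np) // big_pred0 ?addr0 // => l.
    by apply/negbTE; rewrite negb_and -ltnNge (leq_trans _ (ltnW np)) ?orbT // ltn_ord.
  have FS l : (l < n.+1)%N -> F l = if B l then part_factor l * F l.+1 else F l.+1.
    by move=> ln; rewrite /F big_ltn_cond.
  (* This is [(1 - d Q^l) F l = (1 + Q^l) F (l + 1)] rearranged; it makes the sum over the smallest
     part telescope. *)
  have step l : (l < n.+1)%N ->
      (if B l then Q ^+ l * (F l.+1 + d * F l) else 0) = F l - F l.+1.
    move=> /FS ->; case: (boolP (B l)) => [Bl|_]; last by rewrite subrr.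
    rewrite /part_factor; move: (geomK d (B_gt0 _ Bl)); set G := geom _; set R := F _ => GE.
    transitivity (Q ^+ l * R + R * ((1 + Q ^+ l) * G - (1 + Q ^+ l) * ((1 - d * Q ^+ l) * G))).
      by ring.
    by rewrite GE; ring.
  have -> : \sum_(l < n.+1 | B l && (p <= l)%N) Q ^+ l * (F l.+1 + d * F l) =
      \sum_(p <= l < n.+1 | B l) Q ^+ l * (F l.+1 + d * F l).
    by rewrite (big_nat_widenl p 0) // big_mkord.
  rewrite big_mkcond /= (eq_big_nat _ _ (F2 := fun l => F l - F l.+1)); last first.
    by move=> l /andP[_ ln]; apply: step.
  have -> : \sum_(p <= l < n.+1) (F l - F l.+1) = - \sum_(p <= l < n.+1) (F l.+1 - F l).
    by rewrite -sumrN; apply: eq_bigr => l _; rewrite opprB.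
  have Fn : F n.+1 = 1 by rewrite /F big_geq.
  by rewrite telescope_sumr // opprB Fn addrC subrK.
(* A part listed before an overlined [y] is strictly larger; before a non-overlined [y] it may have
   the same size. *)
pose g (y : part) := F (y.1 + y.2)%N.
have B_sum p : \sum_(x : 'I_n.+1 * bool | B x.1 && (p <= x.1)%N)
    part_weight Q d (part_val x) * g (part_val x) =
    \sum_(l < n.+1 | B l && (p <= l)%N) Q ^+ l * (F l.+1 + d * F l).
  rewrite (sum_parts (fun l : 'I_n.+1 => B l && (p <= l)%N)).
  apply: eq_bigr => l _; rewrite /part_weight /g /= addn1 addn0; ring.
rewrite (chain_sum Qn0 (g := g)).
- rewrite -(big_mkord B) -/(F 0%N) F_sum -B_sum; congr (_ + _).
  by apply: eq_bigl => x; rewrite /= andbT.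
- by move=> x /B_gt0.
move=> y _; rewrite {1}/g F_sum -B_sum; congr (_ + _); apply: eq_bigl => x.
rewrite /= /part_before /=; congr (_ && _).
by case: y.2 => /=; rewrite ?addn1 ?addn0 ?andbT ?andbF ?orbF // leq_eqVlt orbC eq_sym.
Qed.

End Products.

(** * Summation over subsets by largest element *)

Section Lex.

Context {K : comNzRingType}.
Variables (r : nat) (b : 'I_r -> nat).

Definition nat_sum (S : {set 'I_r}) : nat := \sum_(i in S) b i.

(** An index rather than an element of [A]; the default [0] concerns the empty set. *)
Definition set_min (S : {set 'I_r}) : nat :=
  if [pick i in S | [forall j in S, (i <= j)%N]] is Some i then i else 0.

Lemma set_minE (i : 'I_r) (S : {set 'I_r}) :
  i \in S -> (forall j, j \in S -> i <= j)%N -> set_min S = i.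
Proof.
move=> iS imin; rewrite /set_min; case: pickP => [k /andP[kS /forall_inP kmin]|/(_ i)].
  by apply/eqP; rewrite eqn_leq kmin // imin.
by rewrite iS /= => /forall_inP[].
Qed.

Lemma set_min_ex S : S != set0 ->
  exists i : 'I_r, [/\ i \in S, forall j, j \in S -> (i <= j)%N & set_min S = i].
Proof.
case/set0Pn=> i0 i0S; case: (arg_minnP (fun i : 'I_r => i : nat) i0S) => i iS imin.
by exists i; split=> //; apply: set_minE.
Qed.

Definition below (j : nat) : {set 'I_r} := [set i : 'I_r | (i < j)%N].

Definition top (j : 'I_r) (S : {set 'I_r}) := (j \in S) && (S \subset below j.+1).

Lemma below_notin (j : 'I_r) (T : {set 'I_r}) : T \subset below j -> j \notin T.
Proof. by move=> /subsetP Tj; apply/negP => /Tj; rewrite inE ltnn. Qed.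

(** The singleton is kept apart because its smallest element is [j] itself; in the other sets,
    removing [j] leaves the smallest element unchanged. *)
Lemma sum_top (j : 'I_r) (F : {set 'I_r} -> K) :
  \sum_(S | top j S) F S =
  F [set j] + \sum_(T : {set 'I_r} | (T != set0) && (T \subset below j)) F (j |: T).
Proof.
have topU T : top j (j |: T) && ((j |: T) :\ j == T) = (T \subset below j).
  rewrite /top setU11 /=; apply/andP/idP => [[/subsetP jT /eqP TE]|Tj].
    apply/subsetP => i iT; have := jT i; rewrite !inE iT orbT ltnS leq_eqVlt => /(_ isT).
    have /negPf ni : i != j by move: iT; rewrite -TE !inE => /andP[].
    by rewrite val_eqE ni.
  split; last by rewrite setU1K // below_notin.
  apply/subsetP => i; rewrite !inE => /predU1P[-> //|/(subsetP Tj)].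
  by rewrite inE => /ltnW.
rewrite (reindex_onto (fun T => j |: T) (fun S => S :\ j)) /=; last first.
  by move=> S /andP[jS _]; rewrite setD1K.
rewrite (eq_bigl _ _ topU) (bigD1 set0) ?sub0set //= setU0; congr (_ + _).
by apply: eq_bigl => T; rewrite andbC.
Qed.

Lemma sum_nonempty (F : {set 'I_r} -> K) :
  \sum_(S : {set 'I_r} | S != set0) F S = \sum_(j : 'I_r) \sum_(S | top j S) F S.
Proof.
rewrite (exchange_big_dep (fun S : {set 'I_r} => S != set0)) /=; last first.
  by move=> j S _ /andP[jS _]; apply/set0Pn; exists j.
apply: eq_bigr => S /set0Pn[i0 i0S].
case: (arg_maxnP (fun i : 'I_r => i : nat) i0S) => j jS jmax.
rewrite (big_pred1 j) // => k; apply/andP/eqP => [[kS /subsetP Sk]|->].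
  apply/val_inj/eqP; rewrite /= eqn_leq; have := Sk j jS; rewrite inE ltnS => -> /=.
  by rewrite andbT; apply: jmax.
by split=> //; apply/subsetP => i iS; rewrite inE ltnS; apply: jmax.
Qed.

Lemma top_exists (j : 'I_r) S j0 : top j S ->
  [exists i : 'I_r in S, (j0 <= i)%N] = (j0 <= j)%N.
Proof.
case/andP=> jS /subsetP Sj; apply/exists_inP/idP => [[i /Sj]|j0j]; last by exists j.
by rewrite inE ltnS => ij /leq_trans; apply.
Qed.

End Lex.

(** * Chain functions indexed by lexicographic bounds *)

Section LexSum.

Context {K : comNzRingType}.
Variables (Q d : K) (n N r : nat) (b : 'I_r -> nat).
Hypotheses (Qn0 : Q ^+ n.+1 = 0) (N_gt0 : (0 < N)%N) (b_gt0 : forall i, (0 < b i)%N).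

(* [lex_ge i0 j0 m S] says that (m, max S) is lexicographically at least (i0, j0). *)
Definition lex_ge (i0 j0 m : nat) (S : {set 'I_r}) : bool :=
  (i0 < m)%N || (m == i0) && [exists j : 'I_r in S, (j0 <= j)%N].

Lemma set_minU (j : 'I_r) (T : {set 'I_r}) : T != set0 -> T \subset below r j ->
  set_min (j |: T) = set_min T.
Proof.
move=> /set_min_ex[i [iT imin ->]] /subsetP Tj.
apply: set_minE => [|k]; first by rewrite !inE iT orbT.
by rewrite !inE => /predU1P[-> |/imin//]; have := Tj i iT; rewrite inE => /ltnW.
Qed.

(** The sum runs over the smallest part [(m, S)]. Its overlined version bounds the next part by
    [(m + |S|, min S)], its non-overlined version, of weight [d], by [(m + |S| - 1, min S)]. *)
Lemma lex_functions : exists h : nat -> nat -> K,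
  (forall i0 j0, (j0 < r)%N -> h j0 i0 = 1 +
     \sum_(m < n.+1) \sum_(S : {set 'I_r} | S != set0)
       if lex_ge i0 j0 m S then Q ^+ (N * m + nat_sum b S) *
         (h (set_min S) (m + #|S|)%N + d * h (set_min S) (m + #|S|).-1) else 0) /\
  h 0%N 0%N * \prod_(m < n.+1) \prod_(l < r) (1 - d * Q ^+ (N * m + b l)) =
  \prod_(m < n.+1) \prod_(l < r) (1 + Q ^+ (N * m + b l)).
Proof.
(* The value outside the index range only has to be positive, so that each [x_l] is a multiple of
   [Q]. *)
pose bn l := if insub l is Some i then b i else 1%N.
have bnE (l : 'I_r) : bn l = b l by rewrite /bn valK.
have bn_gt0 l : (0 < bn l)%N by rewrite /bn; case: insubP.
have qm0 : (Q ^+ N) ^+ n.+1 = 0 by rewrite exprAC Qn0 expr0n gtn_eqF.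
have [h [p [hS pS ph0r h_big h00]]] := chain_functions d qm0 r (fun l => Q ^+ (bn l).-1) Qn0.
have xE l : Q * Q ^+ (bn l).-1 = Q ^+ bn l by rewrite -exprS prednK.
exists h; split; last first.
  move: h00; rewrite (_ : \prod_(i < n.+1) _ = 
    \prod_(m < n.+1) \prod_(l < r) (1 - d * Q ^+ (N * m + b l))); last first.
    by apply: eq_bigr => m _; apply: eq_bigr => l _; rewrite xE bnE -exprM -mulrA -exprD addnC.
  move=> ->; apply: eq_bigr => m _; apply: eq_bigr => l _.
  by rewrite xE bnE -exprM -exprD addnC.
pose below_sum j i := \sum_(T : {set 'I_r} | (T != set0) && (T \subset below r j))
  Q ^+ nat_sum b T * h (set_min T) (i + #|T|)%N.
have sumU (j : 'I_r) (T : {set 'I_r}) : T \subset below r j ->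
    nat_sum b (j |: T) = (b j + nat_sum b T)%N.
  by move=> Tj; rewrite /nat_sum big_setU1 // below_notin.
have cardU (j : 'I_r) (T : {set 'I_r}) : T \subset below r j -> #|j |: T| = #|T|.+1.
  by move=> Tj; rewrite cardsU1 below_notin.
have min1 (j : 'I_r) : set_min [set j] = j.
  by apply: set_minE; rewrite ?set11 // => k; rewrite inE => /eqP->.
have sum1 (j : 'I_r) : nat_sum b [set j] = b j by rewrite /nat_sum big_set1.
(* [p j] collects all sets [T] below [j] that can be joined with [j], the empty one contributing
   [h j]. *)
have pE j i : (j <= r)%N -> p j i = h j i + below_sum j i.
  elim: j i => [|j IHj] i jr.
    rewrite (ph0r i).1 /below_sum big_pred0 ?addr0 // => T.
    have -> : below r 0 = set0 by apply/setP => k; rewrite !inE.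
    by rewrite subset0 andNb.
  rewrite pS !IHj ?(ltnW jr) // [h j i + _]addrC addrK -addrA; congr (_ + _).
  pose o : 'I_r := Ordinal jr.
  rewrite /below_sum [RHS](bigID (fun T : {set 'I_r} => o \notin T)) /=; congr (_ + _).
    apply: eq_bigl => T; rewrite -andbA; congr (_ && _).
    apply/idP/andP => [Tj|[/subsetP Tj oT]].
      split; last by rewrite (@below_notin _ o).
      by apply: subset_trans Tj _; apply/subsetP => k; rewrite !inE => /ltnW.
    apply/subsetP => k kT; have := Tj k kT; rewrite !inE ltnS leq_eqVlt => /predU1P[kj|//].
    by move: oT; rewrite (_ : o = k) ?kT //; apply/val_inj.
  have topoE T : (T != set0) && (T \subset below r j.+1) && ~~ (o \notin T) = top o T.
    rewrite negbK /top [LHS]andbC; case oT: (o \in T) => //=.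
    by have -> : T != set0 by apply/set0Pn; exists o.
  rewrite (eq_bigl _ _ topoE) sum_top sum1 min1 cards1 xE (bnE o) addn1 mulrDr; congr (_ + _).
  rewrite mulr_sumr; apply: eq_bigr => T /andP[T0 Tj].
  by rewrite sumU // cardU // set_minU // addnS addSn exprD mulrA.
pose wt m (S : {set 'I_r}) := Q ^+ (N * m + nat_sum b S) *
         (h (set_min S) (m + #|S|)%N + d * h (set_min S) (m + #|S|).-1).
(* The sets with largest element [j] account for the single step from [h j] to [h (j + 1)]. *)
have topE (j : 'I_r) m : \sum_(S | top j S) wt m S = h j m - h j.+1 m.
  rewrite hS opprB addrC subrK xE bnE !pE ?(ltnW (ltn_ord j)) //.
  rewrite sum_top /wt sum1 min1 cards1 addn1 /= exprD exprM.
  rewrite (_ : \sum_(T | _) _ = Q ^+ b j * (Q ^+ N) ^+ m *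
     (below_sum j m.+1 + d * below_sum j m)); first by ring.
  rewrite /below_sum !mulr_sumr -big_split mulr_sumr; apply: eq_bigr => T /andP[T0 Tj] /=.
  rewrite sumU // cardU // set_minU // addnS /= addSn !exprD exprM; ring.
move=> i0 j0 j0r.
(* One plus the contribution of all rows from [m] on: rows before [i0] contribute nothing, and row
   [i0] counts only sets with largest element at least [j0]. *)
pose psi m := if (m <= i0)%N then h j0 i0 else h 0%N m.
have psiE m : \sum_(S : {set 'I_r} | S != set0) (if lex_ge i0 j0 m S then wt m S else 0) =
   psi m - psi m.+1.
  rewrite sum_nonempty.
  rewrite (eq_bigr (fun j : 'I_r => if (i0 < m)%N || (m == i0) && (j0 <= j)%N
      then h j m - h j.+1 m else 0)); last first.
    move=> j _; rewrite -topE; case: ifP => c; [apply: eq_bigr|apply: big1] => S jS;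
      by rewrite /lex_ge (top_exists _ jS) c.
  have tele m1 k : (k <= r)%N -> \sum_(k <= j < r) (h j m1 - h j.+1 m1) = h k m1 - h r m1.
    move=> kr; rewrite -[RHS]opprB -(telescope_sumr (fun j => h j m1) kr) -sumrN.
    by apply: eq_bigr => j _; rewrite opprB.
  rewrite /psi; have [mi0|i0m|->] := ltngtP m i0.
  - by rewrite big1 // subrr.
  - rewrite -(big_mkord xpredT (fun j => h j m - h j.+1 m)) tele // (ph0r m).2.
    by [].
  - rewrite /= -(big_mkord xpredT (fun j => if (j0 <= j)%N then h j i0 - h j.+1 i0 else 0)).
    rewrite (big_cat_nat _ (n := j0)) ?(ltnW j0r) //= big_nat_cond big1 ?add0r; last first.
      by move=> j /andP[/andP[_ jj0] _]; rewrite ifN // -ltnNge.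
    rewrite -(ph0r i0).2 -tele ?(ltnW j0r) //.
    by apply: eq_big_nat => j /andP[-> _].
transitivity (1 + \sum_(m < n.+1) (psi m - psi m.+1)); last first.
  by congr (_ + _); apply: eq_bigr => m _; rewrite -psiE.
rewrite -(big_mkord xpredT (fun m => psi m - psi m.+1)).
have -> : \sum_(0 <= m < n.+1) (psi m - psi m.+1) = - \sum_(0 <= m < n.+1) (psi m.+1 - psi m).
  by rewrite -sumrN; apply: eq_bigr => m _; rewrite opprB.
rewrite telescope_sumr // opprB {1}/psi leq0n.
(* All [h j] equal [1] beyond [n], which covers both branches of [psi]. *)
have -> : psi n.+1 = 1 by rewrite /psi; case: ifP => [ni0|_]; rewrite h_big.
by rewrite addrC subrK.
Qed.

End LexSum.

(** * The gap condition *)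

Section Encoding.

Variables (r : nat) (a : 'I_r -> int) (N : nat).
Hypothesis a_superincreasing : forall k : 'I_r, \sum_(i < r | (i < k)%N) a i < a k.
Hypothesis sums_distinct :
  {in [set S : {set 'I_r} | S != set0] &, injective (subset_sum a)}.
Hypothesis N_gt0 : (0 < N)%N.
Hypothesis N_ge : \sum_(i < r) a i <= N%:Z.

Definition nat_val (i : 'I_r) : nat := `|a i|%N.

(** Strong induction: the sum of the earlier, positive elements is nonnegative and smaller than
    [a i]. *)
Lemma a_gt0 i : 0 < a i.
Proof.
case: i => m; have [k] := ubnP m; elim: k m => // k IHk m mk mr.
apply: le_lt_trans (a_superincreasing _); apply: sumr_ge0 => i /= im.
by case: i im => i ir /= im; apply/ltW/IHk; apply: leq_trans im _.
Qed.

Lemma nat_valE i : a i = (nat_val i)%:Z.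
Proof. by rewrite /nat_val gez0_abs // ltW ?a_gt0. Qed.

Lemma nat_val_gt0 i : (0 < nat_val i)%N.
Proof. by rewrite -ltz_nat -nat_valE a_gt0. Qed.

Lemma subset_sumE S : subset_sum a S = (nat_sum nat_val S)%:Z.
Proof. by rewrite /nat_sum -natz natr_sum; apply: eq_bigr => i _; rewrite natz nat_valE. Qed.

Lemma nat_sum_gt0 (S : {set 'I_r}) : S != set0 -> (0 < nat_sum nat_val S)%N.
Proof.
case/set0Pn=> i iS; rewrite /nat_sum (bigD1 i) //=.
by have := nat_val_gt0 i; lia.
Qed.

Lemma nat_sum_le (S : {set 'I_r}) : (nat_sum nat_val S <= N)%N.
Proof.
rewrite -lez_nat -subset_sumE; apply: le_trans N_ge.
rewrite /subset_sum [leRHS](bigID (mem S)) /= lerDl.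
by apply: sumr_ge0 => i _; apply/ltW/a_gt0.
Qed.

Lemma nat_val_le i : (nat_val i <= N)%N.
Proof. by have := nat_sum_le [set i]; rewrite /nat_sum big_set1. Qed.

Lemma nat_sum_inj : {in [pred S : {set 'I_r} | S != set0] &, injective (nat_sum nat_val)}.
Proof.
move=> S T S0 T0 ST; apply: sums_distinct; rewrite ?inE //.
by rewrite !subset_sumE ST.
Qed.

Lemma nat_val_sum_lt (k : 'I_r) (S : {set 'I_r}) : S \subset below r k ->
  (nat_sum nat_val S < nat_val k)%N.
Proof.
move=> /subsetP Sk; rewrite -ltz_nat -subset_sumE -nat_valE.
apply: le_lt_trans (a_superincreasing k); rewrite /subset_sum.
rewrite [leRHS](bigID (mem S)) /= [in leRHS](eq_bigl (mem S)) => [|i]; last first.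
  by rewrite /=; case iS: (i \in S); rewrite ?andbF // andbT; have := Sk i iS; rewrite inE.
by rewrite lerDl; apply: sumr_ge0 => i _; apply/ltW/a_gt0.
Qed.

Lemma nat_val_ltn (i j : 'I_r) : (i < j)%N -> (nat_val i < nat_val j)%N.
Proof.
move=> ij; have := @nat_val_sum_lt j [set i]; rewrite /nat_sum big_set1; apply.
by rewrite sub1set inE.
Qed.

Lemma nat_val_leq (i j : 'I_r) : (nat_val i <= nat_val j)%N = (i <= j)%N.
Proof.
have [ij|ji|/val_inj->] := ltngtP i j; last exact: leqnn.
  by apply/ltnW/nat_val_ltn.
by apply/negbTE; rewrite -ltnNge nat_val_ltn.
Qed.

(** By superincrease, elements with index below [k] cannot add up to [a(k)], so the comparison only
    depends on the largest element of [S]. *)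
Lemma nat_val_le_sum (k : 'I_r) (S : {set 'I_r}) :
  (nat_val k <= nat_sum nat_val S)%N = [exists j : 'I_r in S, (k <= j)%N].
Proof.
apply/idP/exists_inP => [kS|[j jS kj]].
  apply/exists_inP; apply: contraLR kS; rewrite negb_exists_in => /forall_inP Sk.
  rewrite -ltnNge; apply: nat_val_sum_lt; apply/subsetP => j /Sk.
  by rewrite inE ltnNge.
rewrite -nat_val_leq in kj; apply: leq_trans kj _.
rewrite /nat_sum (bigD1 j) //=. exact: leq_addr.
Qed.

Lemma beta_part m s : (0 < s <= N)%N -> beta N (N * m + s) = s.
Proof.
move=> /andP[s_gt0 sN]; rewrite /beta mulnC modnMDl.
have [sltN|] := ltnP s N; first by rewrite modn_small // gtn_eqF.
move=> Ns; have -> : s = N by lia.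
by rewrite modnn eqxx.
Qed.

Lemma subset_of_sum S : S != set0 -> subset_of a (nat_sum nat_val S)%:Z = S.
Proof.
move=> S0; rewrite /subset_of; case: pickP => [T /andP[T0 /eqP]|/(_ S)].
  by rewrite -subset_sumE => /sums_distinct; apply; rewrite inE.
by rewrite S0 subset_sumE eqxx.
Qed.

Lemma v_sum S : S != set0 ->
  exists i : 'I_r, set_min S = i /\ v a (nat_sum nat_val S)%:Z = (nat_val i)%:Z.
Proof.
move=> S0; have [i [iS imin iE]] := set_min_ex S0; exists i; split=> //.
rewrite /v subset_of_sum //; case: pickP => [j /andP[jS /forall_inP jmin]|/(_ i)].
  rewrite nat_valE; congr (nat_val _)%:Z; apply/val_inj/eqP; rewrite /= eqn_leq.
  by rewrite (imin j jS) -nat_val_leq -lez_nat -!nat_valE jmin.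
rewrite iS /= => /forall_inP[] j jS.
by rewrite !nat_valE lez_nat nat_val_leq imin.
Qed.

(** With [i0 = m' + |S'| - 1 + chi'], the condition rearranges to [N i0 + v(S') <= N m + alpha(S)].
    Both [v(S')] and [alpha(S)] lie in [1, ..., N], so the comparison is lexicographic. *)
Lemma gap_lex m m' S S' c c' : S != set0 -> S' != set0 ->
  gap a N (N * m + nat_sum nat_val S, c)%N (N * m' + nat_sum nat_val S', c')%N =
  lex_ge (m' + #|S'|.-1 + c') (set_min S') m S.
Proof.
move=> S0 S'0.
have sN : (0 < nat_sum nat_val S <= N)%N by rewrite nat_sum_gt0 ?nat_sum_le.
have s'N : (0 < nat_sum nat_val S' <= N)%N by rewrite nat_sum_gt0 ?nat_sum_le.
rewrite /gap /= beta_part // /w subset_of_sum //.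
have [i [iE ->]] := v_sum S'0; rewrite /lex_ge iE -nat_val_le_sum.
have vN : (0 < nat_val i <= N)%N by rewrite nat_val_gt0 nat_val_le.
have card_gt0 : (0 < #|S'|)%N by rewrite card_gt0.
set i0 := (m' + #|S'|.-1 + c')%N.
transitivity (N * i0 + nat_val i <= N * m + nat_sum nat_val S)%N.
  rewrite -lez_nat; rewrite /i0.
  have -> : (#|S'|)%:Z - 1 = (#|S'|.-1)%:Z by lia.
  apply/idP/idP; nia.
have [lt|gt|<-] := ltngtP i0 m; rewrite ?eqxx /=.
- have : (N * i0.+1 <= N * m)%N by rewrite leq_mul.
  by rewrite mulnS; lia.
- have : (N * m.+1 <= N * i0)%N by rewrite leq_mul.
  by rewrite mulnS; lia.
- by rewrite leq_add2l.
Qed.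

Lemma in_ANE l : in_AN a N l = (0 < l)%N && [exists i, (l == nat_val i %[mod N])].
Proof.
rewrite /in_AN; congr (_ && _); apply: eq_existsb => i.
by rewrite nat_valE !modz_nat.
Qed.

Lemma in_A'NE l : in_A'N a N l =
  (0 < l)%N && [exists S : {set 'I_r}, (S != set0) && (l == nat_sum nat_val S %[mod N])].
Proof.
rewrite /in_A'N; congr (_ && _); apply: eq_existsb => S.
by rewrite subset_sumE !modz_nat.
Qed.


Lemma in_A'N_part l : in_A'N a N l ->
  exists m S, S != set0 /\ l = (N * m + nat_sum nat_val S)%N.
Proof.
rewrite in_A'NE => /andP[l_gt0 /existsP[S /andP[S0 /eqP lS]]].
exists (l.-1 %/ N)%N, S; split=> //.
by apply: residueE; rewrite ?nat_sum_gt0 ?nat_sum_le.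
Qed.

(** The gap condition yields [m >= m'], with equality only if [S'] is a singleton and the later part
    is not overlined; then [alpha(S) >= alpha(S')]. *)
Lemma gap_part_before x y : in_A'N a N x.1 -> in_A'N a N y.1 ->
  gap a N x y -> part_before x y.
Proof.
case: x y => [x c] [y c'] /= /in_A'N_part[m [S [S0 ->]]] /in_A'N_part[m' [S' [S'0 ->]]].
have sN : (0 < nat_sum nat_val S <= N)%N by rewrite nat_sum_gt0 ?nat_sum_le.
have s'N : (0 < nat_sum nat_val S' <= N)%N by rewrite nat_sum_gt0 ?nat_sum_le.
have lt_m : (m' < m)%N -> (N * m' + nat_sum nat_val S' < N * m + nat_sum nat_val S)%N.
  move=> m'm; have : (N * m'.+1 <= N * m)%N by rewrite leq_mul.
  by rewrite mulnS; lia.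
rewrite gap_lex // /part_before /=.
have S'_gt0 : (0 < #|S'|)%N by rewrite card_gt0.
case/orP=> [im|/andP[/eqP mE]]; first by rewrite lt_m //; lia.
have [m'm|m'm] := ltnP m' m; first by rewrite lt_m.
have c'0 : c' = false by move: mE m'm; case: c'; lia.
have S'1 : #|S'| = 1%N.
  move: mE S'_gt0; rewrite c'0 addn0; move: #|_| => q1; lia.
have -> : m = m' by lia.
move/eqP/cards1P: S'1 => [i ->].
have -> : set_min [set i] = i.
  by apply: set_minE; rewrite ?set11 // => k; rewrite inE => /eqP->.
have -> : nat_sum nat_val [set i] = nat_val i by rewrite /nat_sum big_set1.
rewrite -nat_val_le_sum c'0 andbT [in X in _ || X]eq_sym orbC -leq_eqVlt.
by rewrite leq_add2l.
Qed.

(** * Generating functions of the two families *)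

Context {K : comNzRingType}.
Variables (Q d : K) (n : nat).
Hypothesis Qn0 : Q ^+ n.+1 = 0.

Lemma gap_sum : (0 < r)%N ->
  \sum_(l : n.-bseq ('I_n.+1 * bool) |
     all (fun x => in_A'N a N x.1) (overpart_val l) && sorted (gap a N) (overpart_val l))
     \prod_(x <- overpart_val l) part_weight Q d x =
  \prod_(m < n.+1) \prod_(i < r) part_factor Q d n (N * m + nat_val i).
Proof.
move=> r_gt0; have [h [hE h00]] := lex_functions d Qn0 N_gt0 nat_val_gt0.
pose setof l := subset_of a (beta N l)%:Z.
(* The part [y] is decoded into [(m, S)], and [h] is taken at the lexicographic bound that [y]
   imposes on the next larger part. *)
pose g (y : part) := h (set_min (setof y.1)) (y.1.-1 %/ N + #|setof y.1|.-1 + y.2)%N.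
have sN S : S != set0 -> (0 < nat_sum nat_val S <= N)%N.
  by move=> S0; rewrite nat_sum_gt0 ?nat_sum_le.
have gE m S c : S != set0 ->
    g (N * m + nat_sum nat_val S, c)%N = h (set_min S) (m + #|S|.-1 + c)%N.
  move=> S0; have s_gt0 := sN S S0; rewrite /g /setof /= beta_part // subset_of_sum //.
  congr (h _ (_ + _ + _)%N); rewrite -[RHS](mulKn m N_gt0).
  have -> : ((N * m + nat_sum nat_val S).-1 = N * m + (nat_sum nat_val S).-1)%N by lia.
  by rewrite mulnC divnMDl // divn_small ?addn0 ?mulnK //; lia.
(* The two parts of each size are merged, and sizes are replaced by pairs [(m, S)]. *)
have A_sum i0 j0 (c : pred part) :
    (forall m S b, S != set0 -> c (N * m + nat_sum nat_val S, b)%N = lex_ge i0 j0 m S) ->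
  \sum_(x : 'I_n.+1 * bool | in_A'N a N x.1 && c (part_val x))
    part_weight Q d (part_val x) * g (part_val x) =
  \sum_(m < n.+1) \sum_(S : {set 'I_r} | S != set0)
    if lex_ge i0 j0 m S then Q ^+ (N * m + nat_sum nat_val S) *
      (h (set_min S) (m + #|S|)%N + d * h (set_min S) (m + #|S|).-1) else 0.
  move=> cE; rewrite big_mkcondr (sum_parts (fun l : 'I_n.+1 => in_A'N a N l)) /=.
  pose f l := (if c (l, true) then part_weight Q d (l, true) * g (l, true) else 0) +
    (if c (l, false) then part_weight Q d (l, false) * g (l, false) else 0).
  rewrite (eq_big _ (fun l : 'I_n.+1 => f l) (fun l => in_A'NE l)) //.
  rewrite (@big_residues _ _ _ _ _ _ N n f sN nat_sum_inj) => [|l nl].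
    apply: eq_bigr => m _; apply: eq_bigr => S S0; rewrite /f !cE //.
    case: ifP => _; last by rewrite addr0.
    have S_gt0 : (0 < #|S|)%N by rewrite card_gt0.
    rewrite !gE // addn0 -addnA addn1 prednK // /part_weight /= mulr1 -mulrA -mulrDr.
    by rewrite (_ : m + #|S|.-1 = (m + #|S|).-1)%N; last by lia.
  by rewrite /f /part_weight /= (Q_big Qn0) // !mul0r !if_same addr0.
rewrite (chain_sum Qn0 (g := g)) => [|x|[y c] yA].
(* The bound [(0, 0)] admits every part. *)
- transitivity (h 0%N 0%N).
    rewrite hE //; congr (_ + _); rewrite -(A_sum 0%N 0%N predT).
      by apply: eq_bigl => x; rewrite andbT.
    move=> m S b /set0Pn[i iS]; rewrite /lex_ge; case: m => //=.
    by apply/esym/exists_inP; exists i.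
  (* Inserting [(1 - u) geom u = 1] for each factor lets the product formula for [h 0 0] apply. *)
  have -> : h 0%N 0%N = h 0%N 0%N * (\prod_(m < n.+1) \prod_(i < r)
      ((1 - d * Q ^+ (N * m + nat_val i)) * geom n (d * Q ^+ (N * m + nat_val i)))).
    rewrite big1 ?mulr1 // => m _; rewrite big1 // => i _; apply: geomK => //.
    by have := nat_val_gt0 i; lia.
  under eq_bigr do rewrite big_split /=.
  rewrite big_split /= mulrA h00 -big_split /=; apply: eq_bigr => m _.
  by rewrite -big_split.
- by rewrite in_A'NE => /andP[].
have [m' [S' [S'0 /= yE]]] := in_A'N_part yA.
rewrite yE gE // hE; last by have [i [_ _ ->]] := set_min_ex S'0.
congr (_ + _); rewrite -(A_sum _ _ (fun x => gap a N x (N * m' + nat_sum nat_val S', c)%N)) //.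
by move=> m S b S0; rewrite gap_lex.
Qed.

Lemma distinct_sum :
  \sum_(l : n.-bseq ('I_n.+1 * bool) |
     all (fun x => in_AN a N x.1) (overpart_val l) && sorted part_before (overpart_val l))
     \prod_(x <- overpart_val l) part_weight Q d x =
  \prod_(m < n.+1) \prod_(i < r) part_factor Q d n (N * m + nat_val i).
Proof.
rewrite (overpartition_sum d Qn0 (B := in_AN a N)) => [|l /andP[]//].
rewrite (eq_bigl _ _ (fun l : 'I_n.+1 => in_ANE l)).
rewrite -(@big_residues _ _ _ _ predT _ N n (part_factor Q d n)) //.
- by move=> i _; rewrite nat_val_gt0 nat_val_le.
- move=> i j _ _ ij; apply/val_inj/eqP; rewrite /= eqn_leq -!nat_val_leq.
  by rewrite ij leqnn.
- exact: part_factor_big.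
Qed.

End Encoding.

(** * Equality of the two counts *)

Theorem theorem6 (r : nat) (a : 'I_r -> int) (N : nat)
  (r_ge1 : (1 <= r)%N)
  (a_distinct : injective a)
  (a_superincreasing : forall k : 'I_r, \sum_(i < r | (i < k)%N) a i < a k)
  (sums_distinct : {in [set S : {set 'I_r} | S != set0] &, injective (subset_sum a)})
  (N_gt0 : (0 < N)%N)
  (N_ge : \sum_(i < r) a i <= N%:Z)
  (k n : nat) :
  D a N k n = E a N k n.
Proof.
have Qn0 := qvar_nilp n.
have := distinct_sum a_superincreasing N_ge (dvar n) Qn0.
rewrite -(gap_sum a_superincreasing sums_distinct N_gt0 N_ge (dvar n) Qn0 r_ge1).
pose B1 s := all (fun x : part => in_AN a N x.1) s && sorted part_before s.
pose B2 s := all (fun x : part => in_A'N a N x.1) s && sorted (gap a N) s.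
move=> /(@count_from_weights n B1 B2 k) B12; rewrite /D /E /count_overpartitions.
(* Membership in [A_N] or [A'_N] already makes parts positive, and the gap condition implies the
   listing order, so both counts reduce to the families with equal generating functions. *)
transitivity #|[set l : n.-bseq ('I_n.+1 * bool) | [&& B1 (overpart_val l),
     \sum_(x <- overpart_val l) x.1 == n & non_overlined (overpart_val l) == k]]%N|.
  apply: eq_card => l; rewrite !inE /is_overpartition /B1.
  case AN: (all (fun x : part => in_AN a N x.1) _); last by rewrite /= andbF.
  have -> : all (fun x : part => 0 < x.1)%N (overpart_val l).
    by apply: sub_all AN => x /andP[].
  by rewrite /= -andbA.
rewrite B12; apply: eq_card => l; rewrite !inE /is_overpartition /B2.
case A'N: (all (fun x : part => in_A'N a N x.1) _); last by rewrite /= andbF.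
have -> : all (fun x : part => 0 < x.1)%N (overpart_val l).
  by apply: sub_all A'N => x /andP[].
case gap_l: (sorted (gap a N) _); last by rewrite /= !andbF.
have -> : sorted part_before (overpart_val l).
  apply: sub_in_sorted A'N gap_l => x y; exact: gap_part_before.
by rewrite /= andbT.
Qed.
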